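(* Let $\mathcal{S}_1,\dots,\mathcal{S}_N\subset\mathbb{R}^{n_x+1}$ be the controllable sets forming the controllable tube (defined in the context), and let $x=x_{\mathrm{i}}\in\mathbb{R}^{n_x}$ be the initial condition (current state). Let $$\mathcal{K} := \{k\in\{1,\dots,N\} \mid x_{\mathrm{i}}\in\{x \mid (x,c)\in\mathcal{S}_k\}\},$$ $$\mathcal{C}_k(x_{\mathrm{i}}) := \{c \mid (x_{\mathrm{i}},c)\in\mathcal{S}_k\},\quad k\in\mathcal{K},\qquad c_k := \min_{c\in\mathcal{C}_k(x_{\mathrm{i}})} c,$$ where $\{x\mid (x,c)\in\mathcal{S}_k\}$ is the projection of $\mathcal{S}_k$ onto the state coordinates. Thus $\mathcal{K}$ is the set of indices of the controllable sets that contain $x_{\mathrm{i}}$. For $k\in\mathcal{K}$, $\mathcal{C}_k(x_{\mathrm{i}})$ is the slice of $\mathcal{S}_k$ at $x_{\mathrm{i}}$ projected onto the cost-to-go coordinate, and $c_k$ is the minimum of $\mathcal{C}_k(x_{\mathrm{i}})$. Assume that $\mathcal{K}$ is nonempty and that $\mathcal{S}_k$ is compact for all $k\in\mathcal{K}$. Then the globally optimal horizon length (number of steps) is $N-k^\star$, where $$k^\star = \operatorname*{argmin}_{k\in\mathcal{K}}\, c_k,$$ and the corresponding globally optimal cost is $c^\star := c_{k^\star}$.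
   Context: Setting. The augmented state is $(x,c)\in\mathbb{R}^{n_x}\times\mathbb{R}$, where $c$ is the cost-to-go, and the augmented control is $(u,\sigma)\in\mathbb{R}^{n_u}\times\mathbb{R}$. The discrete-time dynamics $$(x_{j+1},c_{j+1}) = A\,(x_j,c_j)+B\,(u_j,\sigma_j)+d$$ are the exact zero-order-hold discretization of $\dot x = A_c x+B_c u+G_c\sigma+d_c$, $\dot c=-\beta\sigma$, where $A_c\in\mathbb{R}^{n_x\times n_x}$, $B_c\in\mathbb{R}^{n_x\times n_u}$, $G_c,d_c\in\mathbb{R}^{n_x}$ and $\beta>0$. The matrix $A$ is a matrix exponential, hence invertible. Let $\tilde{\mathcal{X}}\subset\mathbb{R}^{n_x+1}$ be the state constraint set, $\tilde{\mathcal{U}}\subset\mathbb{R}^{n_u+1}$ the control constraint set, and $\tilde{\mathcal{X}}_{\mathrm{f}}:=\mathcal{X}_{\mathrm{f}}\times\{0\}$ the terminal set, with $\mathcal{X}_{\mathrm{f}}\subset\mathbb{R}^{n_x}$ the target final state set (so the terminal cost-to-go is $0$). All constraint sets are compact. (In the intended application they are convex polytopes, but convexity is not a hypothesis of the theorem.) Controllable tube. A controllable set is the set of all (augmented) initial conditions from which the terminal set is reachable, in the presence of state and control constraints, in a given number of steps. The controllable tube is given by the backward recursion $\mathcal{S}_N:=\tilde{\mathcal{X}}_{\mathrm{f}}$ and, for $k=N-1,N-2,\dots,1$, $$\mathcal{S}_k := \tilde{\mathcal{X}}\cap A^{-1}\bigl(\mathcal{S}_{k+1}\oplus(-B\,\tilde{\mathcal{U}}-d)\bigr),$$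 where $\oplus$ is the Minkowski sum. The backward recursion is assumed to terminate for this finite $N$, i.e. continuing it beyond $\mathcal{S}_1$ yields empty sets. Free-final-time optimal control problem from $x_{\mathrm{i}}$. The decision variables are the horizon length (number of steps) $M$, the controls $(u_1,\sigma_1),\dots,(u_M,\sigma_M)$ and the initial cost-to-go $c_1$. Minimize $c_1$ subject to: the dynamics above for $j=1,\dots,M$; $(x_j,c_j)\in\tilde{\mathcal{X}}$ for $j=1,\dots,M+1$; $(u_j,\sigma_j)\in\tilde{\mathcal{U}}$ for $j=1,\dots,M$; $x_1=x_{\mathrm{i}}$ with $c_1$ free; and $(x_{M+1},c_{M+1})\in\tilde{\mathcal{X}}_{\mathrm{f}}$. The globally optimal horizon length and cost are the minimizing $M$ and the minimum value of $c_1$ over all horizon lengths and controls.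
   Formalization: The formal theorem additionally assumes that the terminal set X_f × {0} is contained in the state constraint set; without this the claim fails, since the control problem also imposes the state constraint at the final step while S_N is not intersected with that set. *)

(* Defs.v *)
From HB Require Import structures.
From mathcomp Require Import all_boot all_order all_algebra.
From mathcomp Require Import all_classical all_reals all_analysis.

Set Implicit Arguments.
Unset Strict Implicit.
Unset Printing Implicit Defensive.

Import Order.TTheory GRing.Theory Num.Theory.
Import numFieldNormedType.Exports.

Local Open Scope classical_set_scope.
Local Open Scope ring_scope.

(* The limit is taken entrywise, so that no dimension has to be nonzero. *)
Definition mexp (R : realType) (n : nat) (M : 'M[R]_n) : 'M[R]_n :=
  \matrix_(i, j) limn (fun m : nat => (\sum_(k < m) (k`!%:R)^-1 *: M ^+ k) i j).

(* Augmented vectors: (x, c) in R^n x R is the column vector stacking x on c. *)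
Definition aug (R : realType) (n : nat) (x : 'cV[R]_n) (c : R) : 'cV[R]_(n + 1) :=
  col_mx x c%:M.

(* The system  x' = Ac x + Bc u + Gc sigma + dc,  c' = - beta sigma  written as
   z' = aug_A z + aug_B v + aug_d  with  z = (x, c)  and  v = (u, sigma). *)
Definition aug_A (R : realType) (nx : nat) (Ac : 'M[R]_nx) : 'M[R]_(nx + 1) :=
  block_mx Ac 0 0 0.

Definition aug_B (R : realType) (nx nu : nat) (Bc : 'M[R]_(nx, nu))
    (Gc : 'cV[R]_nx) (beta : R) : 'M[R]_(nx + 1, nu + 1) :=
  block_mx Bc Gc 0 (- beta)%:M.

Definition aug_d (R : realType) (nx : nat) (dc : 'cV[R]_nx) : 'cV[R]_(nx + 1) :=
  aug dc 0.

(* Entrywise integral of exp (s M) over 0 <= s <= h. *)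
Definition mexp_int (R : realType) (n : nat) (M : 'M[R]_n) (h : R) : 'M[R]_n :=
  \matrix_(i, j) Rintegral lebesgue_measure `[0, h] (fun s : R => mexp (s *: M) i j).

(* Exact zero-order-hold discretization with sampling period h: by variation of
   constants, under a constant input v the solution of z' = aug_A z + aug_B v + aug_d
   satisfies
   z(t + h) = exp (h aug_A) z(t) + (int_0^h exp (s aug_A) ds) (aug_B v + aug_d). *)
Definition exact_zoh (R : realType) (nx nu : nat) (Ac : 'M[R]_nx)
    (Bc : 'M[R]_(nx, nu)) (Gc dc : 'cV[R]_nx) (beta h : R)
    (A : 'M[R]_(nx + 1)) (B : 'M[R]_(nx + 1, nu + 1)) (d : 'cV[R]_(nx + 1)) : Prop :=
  [/\ A = mexp (h *: aug_A Ac),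
      B = mexp_int (aug_A Ac) h *m aug_B Bc Gc beta &
      d = mexp_int (aug_A Ac) h *m aug_d dc].

Definition terminal_set (R : realType) (nx : nat) (Xf : set 'cV[R]_nx) :
  set 'cV[R]_(nx + 1) := [set aug x 0 | x in Xf].

Definition msum (R : realType) (n : nat) (S T : set 'cV[R]_n) : set 'cV[R]_n :=
  [set s + t | s in S & t in T].

Definition back_step (R : realType) (nz nv : nat) (A : 'M[R]_nz)
    (B : 'M[R]_(nz, nv)) (d : 'cV[R]_nz) (X : set 'cV[R]_nz) (U : set 'cV[R]_nv)
    (S : set 'cV[R]_nz) : set 'cV[R]_nz :=
  X `&` [set invmx A *m w | w in msum S [set - (B *m v) - d | v in U]].

(* Only the values S 1, ..., S N are constrained. *)
Definition controllable_tube (R : realType) (nz nv : nat) (A : 'M[R]_nz)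
    (B : 'M[R]_(nz, nv)) (d : 'cV[R]_nz) (X : set 'cV[R]_nz) (U : set 'cV[R]_nv)
    (F : set 'cV[R]_nz) (N : nat) (S : nat -> set 'cV[R]_nz) : Prop :=
  S N = F /\
  forall k : nat, (1 <= k < N)%N -> S k = back_step A B d X U (S k.+1).

Definition tube_terminates (R : realType) (nz nv : nat) (A : 'M[R]_nz)
    (B : 'M[R]_(nz, nv)) (d : 'cV[R]_nz) (X : set 'cV[R]_nz) (U : set 'cV[R]_nv)
    (S : nat -> set 'cV[R]_nz) : Prop :=
  forall m : nat, iter m.+1 (back_step A B d X U) (S 1%N) = set0.

Definition state_proj (R : realType) (nx : nat) (S : set 'cV[R]_(nx + 1)) :
  set 'cV[R]_nx := [set x | exists c : R, S (aug x c)].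

Definition cost_slice (R : realType) (nx : nat) (S : set 'cV[R]_(nx + 1))
    (x : 'cV[R]_nx) : set R := [set c | S (aug x c)].

Definition tube_indices (R : realType) (nx : nat) (N : nat)
    (S : nat -> set 'cV[R]_(nx + 1)) (x : 'cV[R]_nx) : set nat :=
  [set k | (1 <= k <= N)%N /\ state_proj (S k) x].

Definition is_min (R : realType) (C : set R) (m : R) : Prop :=
  C m /\ forall c : R, C c -> m <= c.

(* The minimum of C; the junk value 0 is returned when C has no minimum. *)
Definition min_of (R : realType) (C : set R) : R := xget 0 [set m | is_min C m].

Definition slice_min (R : realType) (nx : nat) (S : nat -> set 'cV[R]_(nx + 1))
    (x : 'cV[R]_nx) (k : nat) : R := min_of (cost_slice (S k) x).

(* All minimizers: the minimum may be attained at several indices. *)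
Definition argmin (R : realType) (K : set nat) (f : nat -> R) : set nat :=
  [set k | K k /\ forall l : nat, K l -> f k <= f l].

(* The horizon M may be 0, and only the values v 1, ..., v M and
   z 1, ..., z M.+1 matter. *)
Definition ocp_feasible (R : realType) (nx nv : nat) (A : 'M[R]_(nx + 1))
    (B : 'M[R]_(nx + 1, nv)) (d : 'cV[R]_(nx + 1)) (X : set 'cV[R]_(nx + 1))
    (U : set 'cV[R]_nv) (F : set 'cV[R]_(nx + 1)) (xi : 'cV[R]_nx)
    (M : nat) (v : nat -> 'cV[R]_nv) (c1 : R) : Prop :=
  exists z : nat -> 'cV[R]_(nx + 1),
    [/\ z 1%N = aug xi c1,
        forall j : nat, (1 <= j <= M)%N -> z j.+1 = A *m z j + B *m v j + d,
        forall j : nat, (1 <= j <= M.+1)%N -> X (z j),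
        forall j : nat, (1 <= j <= M)%N -> U (v j) &
        F (z M.+1)].

Definition ocp_optimal (R : realType) (nx nv : nat) (A : 'M[R]_(nx + 1))
    (B : 'M[R]_(nx + 1, nv)) (d : 'cV[R]_(nx + 1)) (X : set 'cV[R]_(nx + 1))
    (U : set 'cV[R]_nv) (F : set 'cV[R]_(nx + 1)) (xi : 'cV[R]_nx)
    (M : nat) (v : nat -> 'cV[R]_nv) (c1 : R) : Prop :=
  ocp_feasible A B d X U F xi M v c1 /\
  forall (M' : nat) (v' : nat -> 'cV[R]_nv) (c1' : R),
    ocp_feasible A B d X U F xi M' v' c1' -> c1 <= c1'.

Definition optimal_horizon_cost (R : realType) (nx nv : nat) (A : 'M[R]_(nx + 1))
    (B : 'M[R]_(nx + 1, nv)) (d : 'cV[R]_(nx + 1)) (X : set 'cV[R]_(nx + 1))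
    (U : set 'cV[R]_nv) (F : set 'cV[R]_(nx + 1)) (xi : 'cV[R]_nx)
    (M : nat) (c : R) : Prop :=
  exists v : nat -> 'cV[R]_nv, ocp_optimal A B d X U F xi M v c.

(* Main.v *)
(* The state A z + B v + d lies in S_{k+1} for some admissible v exactly when z
   lies in A^-1 (S_{k+1} (+) (- B U - d)), because A is invertible.  Hence the
   horizons M that are feasible from (xi, c) are exactly those with M < N and
   (xi, c) in S_{N-M}: a longer trajectory would pass through a set before S_1,
   and these are empty.  The optimal control problem is thus the minimization of
   c over the slices of S_1, ..., S_N at xi, which are compact.

   Invertibility of A comes from exp(M) exp(-M) = 1, proved on truncated series:
   if E_m is the m-th truncation and |M i j| <= b, then E_m(M) E_m(-M) differs
   from 1 entrywise by at most E_m(a)^2 - E_m(2 a) with a = n b, which tends to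
   exp(a)^2 - exp(2 a) = 0. *)
Require Import Defs.
From HB Require Import structures.
From mathcomp Require Import all_boot all_order all_algebra.
From mathcomp Require Import all_classical all_reals all_analysis.
From mathcomp Require Import ring zify.

Import Order.TTheory GRing.Theory Num.Theory.
Import numFieldNormedType.Exports.

Local Open Scope classical_set_scope.
Local Open Scope ring_scope.

(** * Invertibility of the matrix exponential *)

(* Used with c = -1, where the right-hand side is G 0, for the entries of the
   powers of a matrix, and with c = 1 for the powers of a scalar. *)
Lemma sum_exp_convolution (R : numFieldType) (c : R) (G : nat -> R) (m : nat) :
  \sum_(k < m) \sum_(l < m | (k + l < m)%N)
     (k`!%:R)^-1 * ((l`!%:R)^-1 * c ^+ l) * G (k + l)%N =
  \sum_(n < m) (n`!%:R)^-1 * (1 + c) ^+ n * G n.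
Proof.
(* Reindexing by [n = k + l]; the binomial theorem then recognizes the inner sum over [l] as
   [(1 + c) ^+ n] divided by [n!]. *)
transitivity (\sum_(n < m) \sum_(l < m | (l <= n)%N)
    ((n - l)`!%:R)^-1 * ((l`!%:R)^-1 * c ^+ l) * G n); last first.
  apply: eq_bigr => n _; rewrite exprDn mulr_sumr mulr_suml.
  rewrite (big_ord_widen m
    (fun l => n`!%:R^-1 * (1 ^+ (n - l) * c ^+ l *+ 'C(n, l)) * G n))//.
  apply: eq_bigr => l; rewrite /= => ln.
  congr (_ * _); rewrite expr1n mul1r -[c ^+ l *+ _]mulr_natl -(bin_fact ln).
  have b0 : ('C(n, l)%:R : R) != 0 by rewrite pnatr_eq0 -lt0n bin_gt0.
  by rewrite !natrM; field; rewrite b0 !pnatr_eq0 -!lt0n !fact_gt0.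
(* With [l] outermost on both sides, the shift [k = n - l] matches the inner sums. *)
rewrite (exchange_big_dep xpredT)//= [RHS](exchange_big_dep xpredT)//=.
apply: eq_bigr => l _.
rewrite -(big_mkord (fun k => k + l < m)%N
  (fun k => k`!%:R^-1 * (l`!%:R^-1 * c ^+ l) * G (k + l)%N)).
rewrite -(big_mkord (fun n => l <= n)%N
  (fun n => (n - l)`!%:R^-1 * (l`!%:R^-1 * c ^+ l) * G n)).
rewrite -(big_nat_widenl l 0 m xpredT)// -[l in \sum_(l <= _ < _) _]add0n big_addn.
rewrite (big_nat_widen 0 (m - l) m) ?leq_subr//.
by apply: eq_big => k; rewrite ?addnK// ltn_subRL addnC.
Qed.

(** Each product contributes a factor [n] from its inner sum. One spare factor [n] for positive [k]
    turns the bound into a pure power, comparable with a scalar exponential series. *)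
Lemma ler_norm_exp_mx (R : realType) (n : nat) (M : 'M[R]_n) (b : R) (k : nat) :
  (forall i j, `|M i j| <= b) -> forall i j, `|(M ^+ k) i j| <= (n%:R * b) ^+ k.
Proof.
move=> Mb; elim: k => [|k IH] i j.
  by rewrite [M ^+ 0]expr0 expr0 -[_ 1 i j]/(1%:M i j) mxE; case: eqP => _;
    rewrite ?normr1 ?normr0.
rewrite !exprSr mxE (le_trans (ler_norm_sum _ _ _))//.
apply: (@le_trans _ _ (\sum_(l < n) (n%:R * b) ^+ k * b)).
  by apply: ler_sum => l _; rewrite normrM ler_pM.
by rewrite sumr_const card_ord -[_ *+ n]mulr_natl mulrCA.
Qed.

(** Entrywise absolute convergence by comparison with the scalar series of exp([n%:R * b]), so the
    [limn] in [mexp] is a genuine limit. *)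
Lemma cvg_mexp (R : realType) (n : nat) (M : 'M[R]_n) (b : R) :
  (forall i j, `|M i j| <= b) -> forall i j,
  (\sum_(k < m) (k`!%:R)^-1 *: M ^+ k) i j @[m --> \oo] --> mexp M i j.
Proof.
move=> Mb i j; rewrite mxE.
pose u k := (k`!%:R)^-1 * (M ^+ k) i j.
have -> : (fun m => (\sum_(k < m) (k`!%:R)^-1 *: M ^+ k) i j) = series u.
  apply/funext => m; rewrite summxE /series /= big_mkord.
  by apply: eq_bigr => k _; rewrite mxE.
suff: cvgn (series u) by [].
apply: normed_cvg; apply: series_le_cvg (is_cvg_series_exp_coeff (n%:R * b)) => k //=.
  by rewrite /exp_coeff /= divr_ge0//
    (le_trans (normr_ge0 _) (ler_norm_exp_mx _ _ _ _ k Mb i j)).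
by rewrite /exp_coeff /= normrM ger0_norm// mulrC ler_wpM2r// ler_norm_exp_mx.
Qed.

Lemma mx_entries_bounded (R : realType) (n : nat) (M : 'M[R]_n) :
  exists b : R, forall i j, `|M i j| <= b.
Proof.
exists (\sum_i \sum_j `|M i j|) => i j.
rewrite (bigD1 i)//= (bigD1 j)//= -addrA lerDl addr_ge0//.
  by apply: sumr_ge0.
by do 2 apply: sumr_ge0 => ? _.
Qed.

Lemma cvg_exp_coeff_tail (R : realType) (a : R) :
  \sum_(k < m) \sum_(l < m | ~~ (k + l < m)%N)
     (k`!%:R)^-1 * (l`!%:R)^-1 * a ^+ (k + l) @[m --> \oo] --> 0.
Proof.
have cvgE (x : R) : series (exp_coeff x) m @[m --> \oo] --> expR x.
  exact: is_cvg_series_exp_coeff.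
have e0 : expR a * expR a - expR (a + a) = 0 by rewrite expRD subrr.
rewrite (_ : (fun m => _) = (fun m => series (exp_coeff a) m *
    series (exp_coeff a) m - series (exp_coeff (a + a)) m)).
  by rewrite -[X in _ --> X]e0; apply: cvgB; [apply: cvgM|]; exact: cvgE.
apply/funext => m.
rewrite /series /= !big_mkord.
have := @sum_exp_convolution R 1 (fun k => a ^+ k) m.
under [RHS]eq_bigr => k _ do
  rewrite -mulrA -exprMn mulrDl !mul1r mulrC.
move=> <-; rewrite mulr_suml -sumrB; apply: eq_bigr => k _.
(* The square of pairs [(k, l)] splits into the triangle [k + l < m], which cancels the truncated
   series of [a + a], and the tail. *)
rewrite mulr_sumr [X in _ = X - _](bigID (fun l : 'I_m => (k + l < m)%N))/=.
rewrite [X in _ = X - _]addrC.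
have e l : exp_coeff a k * exp_coeff a l =
    (k`!%:R)^-1 * (l`!%:R)^-1 * a ^+ (k + l) by rewrite /exp_coeff /= exprD; ring.
under [X in _ - X]eq_bigr => l _ do rewrite expr1n mulr1 -e.
by rewrite addrK; apply: eq_bigr => l _; rewrite e.
Qed.

Lemma mulmx_mexpN (R : realType) (n : nat) (M : 'M[R]_n) :
  mexp M *m mexp (- M) = 1%:M.
Proof.
have [b Mb] := mx_entries_bounded _ _ M.
have MNb i j : `|(- M) i j| <= b by rewrite mxE normrN.
pose E (P : 'M[R]_n) m := \sum_(k < m) (k`!%:R)^-1 *: P ^+ k.
apply/matrixP => i j; apply/eqP; rewrite -subr_eq0; apply/eqP.
have cvgE : (E M m *m E (- M) m) i j - 1%:M i j @[m --> \oo] -->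
    (mexp M *m mexp (- M)) i j - 1%:M i j.
  apply: cvgB; last exact: cvg_cst.
  rewrite mxE; under eq_cvg => m do rewrite mxE.
  apply: cvg_big => [|l _]; first exact: add_continuous.
  by apply: cvgM; exact: cvg_mexp.
apply: (cvg_unique _ cvgE) => //; apply: norm_cvg0.
apply: squeeze_cvgr (cvg_cst 0) (cvg_exp_coeff_tail _ (n%:R * b)).
(* For [m = 0] the truncations are empty; from [m = 1] on they contain the identity term. *)
exists 1%N => // m m0; rewrite normr_ge0/=.
have -> : (E M m *m E (- M) m) i j = \sum_(k < m) \sum_(l < m)
    (k`!%:R)^-1 * ((l`!%:R)^-1 * (-1) ^+ l) * (M ^+ (k + l)) i j.
  rewrite /E mulmx_suml summxE; apply: eq_bigr => k _.
  rewrite mulmx_sumr summxE; apply: eq_bigr => l _.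
  have -> : (- M) ^+ l = (-1) ^+ l *: M ^+ l.
    elim: (l : nat) => [|p IHp]; first by rewrite !expr0 scale1r.
    rewrite !exprS IHp !mulNr mul1r scaleNr; congr (- _).
    by rewrite [RHS]scalemxAr.
  rewrite scalerA -scalemxAl -scalemxAr scalerA mxE; congr (_ * _).
  by rewrite exprD.
(* With [c = -1] the triangle collapses to powers of [1 - 1 = 0], leaving only the term [M ^+ 0]. *)
have -> : 1%:M i j = \sum_(k < m) \sum_(l < m | (k + l < m)%N)
    (k`!%:R)^-1 * ((l`!%:R)^-1 * (-1) ^+ l) * (M ^+ (k + l)) i j.
  rewrite (sum_exp_convolution _ _ (fun k => (M ^+ k) i j)) subrr.
  case: m m0 => // m _; rewrite big_ord_recl big1 => [|k _].
    by rewrite expr0 fact0 invr1 !mul1r addr0.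
  by rewrite expr0n mulr0 mul0r.
rewrite -sumrB (le_trans (ler_norm_sum _ _ _))//; apply: ler_sum => k _.
(* Only pairs with [m <= k + l] survive; they are bounded termwise by the scalar tail. *)
rewrite (bigID (fun l : 'I_m => (k + l < m)%N))/= addrAC subrr add0r.
rewrite (le_trans (ler_norm_sum _ _ _))//; apply: ler_sum => l _.
rewrite normrM ler_pM//.
  rewrite !normrM normrX normrN1 expr1n mulr1 !ger0_norm//.
exact: ler_norm_exp_mx.
Qed.

Lemma mexp_unitmx (R : realType) (n : nat) (M : 'M[R]_n) : mexp M \in unitmx.
Proof. by case: (mulmx1_unit (mulmx_mexpN R n M)). Qed.

(** * Backward steps and minima of slices *)

Lemma back_stepP (R : realType) (nz nv : nat) (A : 'M[R]_nz) (B : 'M[R]_(nz, nv))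
    (d : 'cV[R]_nz) (X : set 'cV[R]_nz) (U : set 'cV[R]_nv) (S : set 'cV[R]_nz)
    (z : 'cV[R]_nz) : A \in unitmx ->
  back_step A B d X U S z <-> X z /\ exists2 v, U v & S (A *m z + B *m v + d).
Proof.
move=> Au; split=> [[Xz [w [s Ss [t [v Uv <-] <-]] wz]]|[Xz [v Uv Sv]]]; split=> //.
  by exists v => //; rewrite -wz mulKVmx// addrA addrAC subrK subrK.
exists (A *m z); last by rewrite mulKmx.
exists (A *m z + B *m v + d) => //; exists (- (B *m v) - d); first by exists v.
by rewrite addrA addrAC addrK addrK.
Qed.

(** The slice is the image under the last coordinate of [S] intersected with a closed fiber. This
    set is compact, so the continuous last coordinate attains its minimum on it. *)
Lemma cost_slice_min (R : realType) (nx : nat) (S : set 'cV[R]_(nx + 1))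
    (x : 'cV[R]_nx) : compact S -> cost_slice S x !=set0 ->
  is_min (cost_slice S x) (min_of (cost_slice S x)).
Proof.
move=> Sc [c0 Sc0]; apply: (@xgetPex _ 0 [set m | is_min (cost_slice S x) m]).
pose last_coord (z : 'cV[R]_(nx + 1)) : R := z (rshift nx ord0) ord0.
pose fiber := \bigcap_(i in [set: 'I_nx])
  [set z : 'cV[R]_(nx + 1) | z (lshift 1 i) ord0 = x i ord0].
have augE c : last_coord (aug x c) = c.
  by rewrite /last_coord /aug col_mxEd mxE.
have fiber_aug c : fiber (aug x c) by move=> i _; rewrite /= /aug col_mxEu.
have fiberP z : fiber z -> z = aug x (last_coord z).
  move=> fz; apply/matrixP => i j; rewrite (ord1 j).
  case: (split_ordP i) => l ->; first by rewrite /aug col_mxEu; exact: fz.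
  by rewrite /aug col_mxEd mxE (ord1 l).
have fiber_closed : closed fiber.
  apply: closed_bigI => i _.
  have /continuous_closedP cc := @coord_continuous R (nx + 1) 1 (lshift 1 i) ord0.
  have cl : closed [set y : R | y = x i ord0] by [].
  exact: cc cl.
have [|||z] := @compact_EVT_min _ R last_coord (S `&` fiber).
- by exists (aug x c0).
- exact: compact_closedI.
- by apply: continuous_subspaceT; exact: coord_continuous.
rewrite inE => -[Sz fz] zmin; exists (last_coord z); split.
  by rewrite /cost_slice /= -fiberP.
by move=> c Sxc; rewrite -(augE c); apply: zmin; rewrite inE.
Qed.

(** * Correspondence between feasible trajectories and the tube *)

Section tube_feasibility.
Variables (R : realType) (nx nv : nat).
Variables (A : 'M[R]_(nx + 1)) (B : 'M[R]_(nx + 1, nv)) (d : 'cV[R]_(nx + 1)).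
Variables (X F : set 'cV[R]_(nx + 1)) (U : set 'cV[R]_nv).
Variables (N : nat) (S : nat -> set 'cV[R]_(nx + 1)).
Hypotheses (Au : A \in unitmx) (FX : F `<=` X).
Hypothesis hS : controllable_tube A B d X U F N S.

(** Each backward step supplies one control to prepend. [FX] gives the state constraint at the final
    point, since [S N] is [F] itself, without intersection with [X]. *)
Lemma tube_trajectory (m : nat) (z : 'cV[R]_(nx + 1)) :
  (m < N)%N -> S (N - m)%N z ->
  exists (w : nat -> 'cV[R]_(nx + 1)) (v : nat -> 'cV[R]_nv),
    [/\ w 1%N = z,
        forall j : nat, (1 <= j <= m)%N -> w j.+1 = A *m w j + B *m v j + d,
        forall j : nat, (1 <= j <= m.+1)%N -> X (w j),
        forall j : nat, (1 <= j <= m)%N -> U (v j) &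
        F (w m.+1)].
Proof.
elim: m z => [|m IH] z mN Sz.
  exists (fun=> z), (fun=> 0); split=> //.
  - by case.
  - by move=> j _; apply: FX; rewrite -hS.1 -(subn0 N).
  - by case.
  - by rewrite -hS.1 -(subn0 N).
have kN : (1 <= N - m.+1 < N)%N by rewrite subn_gt0 mN ltn_subrL (leq_trans _ mN).
move: Sz; rewrite hS.2// => /back_stepP -/(_ Au)[Xz [u Uu]].
rewrite (subnSK (ltnW mN)) => /(IH _ (ltnW mN))[w [v [w1 wS wX vU wF]]].
(* Index 1 carries the new state, later indices the inductive trajectory delayed by one; index 0
   gets a default value. *)
exists (fun j => if j is j'.+2 then w j'.+1 else z).
exists (fun j => if j is j'.+2 then v j'.+1 else u); split=> //.
- by case=> [|[|j]] //= jm; exact: wS.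
- by case=> [|[|j]] //= jm; exact: wX.
- by case=> [|[|j]] //= jm; exact: vU.
Qed.

Lemma trajectory_tube (M : nat) (w : nat -> 'cV[R]_(nx + 1))
    (v : nat -> 'cV[R]_nv) :
  (forall j : nat, (1 <= j <= M)%N -> w j.+1 = A *m w j + B *m v j + d) ->
  (forall j : nat, (1 <= j <= M.+1)%N -> X (w j)) ->
  (forall j : nat, (1 <= j <= M)%N -> U (v j)) ->
  F (w M.+1) ->
  forall m : nat, (m <= M)%N -> (m < N)%N -> S (N - m)%N (w (M.+1 - m)%N).
Proof.
move=> wS wX vU wF; elim=> [|m IH] mM mN; first by rewrite !subn0 hS.1.
have kN : (1 <= N - m.+1 < N)%N by rewrite subn_gt0 mN ltn_subrL (leq_trans _ mN).
have jM : (1 <= M - m <= M)%N by rewrite subn_gt0 mM leq_subr.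
rewrite hS.2// subSS; apply/back_stepP => //; split.
  by apply: wX; case/andP: jM => -> /leqW.
exists (v (M - m)%N); first exact: vU.
rewrite -wS// (subnSK (ltnW mN)) -subSn ?(ltnW mM)//.
exact: IH (ltnW mM) (ltnW mN).
Qed.

Hypothesis hterm : tube_terminates A B d X U S.

Lemma horizon_lt (M : nat) (w : nat -> 'cV[R]_(nx + 1)) (v : nat -> 'cV[R]_nv) :
  (0 < N)%N ->
  (forall j : nat, (1 <= j <= M)%N -> w j.+1 = A *m w j + B *m v j + d) ->
  (forall j : nat, (1 <= j <= M.+1)%N -> X (w j)) ->
  (forall j : nat, (1 <= j <= M)%N -> U (v j)) ->
  F (w M.+1) -> (M < N)%N.
Proof.
move=> N0 wS wX vU wF; rewrite ltnNge; apply/negP => NM.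
(* If [N <= M], then [N - 1] steps remain at time [(M - N).+2], so the state there lies in [S 1]. *)
have S1 : S 1%N (w (M - N).+2).
  have := @trajectory_tube M w v wS wX vU wF N.-1.
  have -> : (N - N.-1 = 1)%N by lia.
  have -> : (M.+1 - N.-1 = (M - N).+2)%N by lia.
  by apply; lia.
(* Going back [i.+1] more steps stays in the iterates beyond [S 1]; at [i = M - N] the initial state
   would lie in an empty set. *)
suff /(_ (M - N)%N) : forall i, (i <= M - N)%N ->
    iter i.+1 (back_step A B d X U) (S 1%N) (w (M - N - i).+1).
  by rewrite hterm leqnn; apply.
have sub i : (i <= M - N)%N -> (1 <= (M - N - i).+1 <= M)%N by lia.
elim=> [|i IH] iMN; rewrite iterS; apply/back_stepP => //.
  split; first by apply: wX; lia.
  by exists (v (M - N - 0).+1); [exact: vU (sub 0%N iMN)|rewrite -wS ?subn0//; lia].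
split; first by apply: wX; lia.
exists (v (M - N - i.+1).+1); first exact: vU (sub _ iMN).
by rewrite -wS ?sub// subnSK//; exact: IH (ltnW iMN).
Qed.

Lemma ocp_feasible_tube (xi : 'cV[R]_nx) (M : nat) (c : R) : (0 < N)%N ->
  (exists v, ocp_feasible A B d X U F xi M v c) <->
  (M < N)%N /\ cost_slice (S (N - M)%N) xi c.
Proof.
move=> N0; split=> [[v [z [z1 zS zX vU zF]]]|[MN /(tube_trajectory _ _ MN)]].
  have MN := horizon_lt _ _ _ N0 zS zX vU zF; split=> //.
  have := trajectory_tube _ _ _ zS zX vU zF _ (leqnn M) MN.
  by rewrite subSnn z1.
by move=> [w [v [w1 wS wX vU wF]]]; exists v, w.
Qed.

End tube_feasibility.

Theorem theorem1 (R : realType) (nx nu : nat)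
    (Ac : 'M[R]_nx) (Bc : 'M[R]_(nx, nu)) (Gc dc : 'cV[R]_nx) (beta h : R)
    (hbeta : 0 < beta) (hh : 0 < h)
    (A : 'M[R]_(nx + 1)) (B : 'M[R]_(nx + 1, nu + 1)) (d : 'cV[R]_(nx + 1))
    (hzoh : exact_zoh Ac Bc Gc dc beta h A B d)
    (X : set 'cV[R]_(nx + 1)) (U : set 'cV[R]_(nu + 1)) (Xf : set 'cV[R]_nx)
    (hX : compact X) (hU : compact U) (hXf : compact Xf)
    (hXfX : terminal_set Xf `<=` X)
    (N : nat) (S : nat -> set 'cV[R]_(nx + 1))
    (hS : controllable_tube A B d X U (terminal_set Xf) N S)
    (hterm : tube_terminates A B d X U S)
    (xi : 'cV[R]_nx)
    (hK : tube_indices N S xi !=set0)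
    (hcomp : forall k : nat, tube_indices N S xi k -> compact (S k)) :
  [/\ forall k : nat, tube_indices N S xi k ->
        is_min (cost_slice (S k) xi) (slice_min S xi k),
      argmin (tube_indices N S xi) (slice_min S xi) !=set0,
      forall kstar : nat, argmin (tube_indices N S xi) (slice_min S xi) kstar ->
        optimal_horizon_cost A B d X U (terminal_set Xf) xi
          (N - kstar)%N (slice_min S xi kstar) &
      forall (M : nat) (c : R),
        optimal_horizon_cost A B d X U (terminal_set Xf) xi M c ->
        exists kstar : nat,
          [/\ argmin (tube_indices N S xi) (slice_min S xi) kstar,
              M = (N - kstar)%N & c = slice_min S xi kstar]].
Proof.
have Au : A \in unitmx by case: hzoh => -> _ _; exact: mexp_unitmx.
have N0 : (0 < N)%N by case: hK => k [/andP[k1 kN] _]; exact: leq_trans kN.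
have feasP := ocp_feasible_tube _ _ _ _ _ _ _ _ _ _ _ Au hXfX hS hterm xi _ _ N0.
have minP k : tube_indices N S xi k ->
    is_min (cost_slice (S k) xi) (slice_min S xi k).
  by move=> Kk; apply: cost_slice_min; [exact: hcomp|case: Kk => _ [] c; exists c].
have feas_index M c : (exists v, ocp_feasible A B d X U (terminal_set Xf) xi M v c) ->
    [/\ (M < N)%N, tube_indices N S xi (N - M)%N & cost_slice (S (N - M)%N) xi c].
  move=> /feasP[MN Sc]; split=> //; split; last by exists c.
  by rewrite subn_gt0 MN leq_subr.
have index_feas k : tube_indices N S xi k ->
    exists v, ocp_feasible A B d X U (terminal_set Xf) xi (N - k)%N v (slice_min S xi k).
  move=> Kk; case: (Kk) => /andP[k1 kN] _.
  by apply/feasP; rewrite subKn// ltn_subrL k1 N0; split=> //; exact: (minP k Kk).1.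
split=> //.
- case: hK => k0 Kk0.
  have k0N : (k0 < N.+1)%N by case: Kk0 => /andP[].
  (* All tube indices are at most [N], so a minimizer exists by finiteness of ['I_N.+1]. *)
  have := @arg_minP _ R 'I_N.+1 (Ordinal k0N)
    (fun k => `[< tube_indices N S xi k >]) (fun k => slice_min S xi k).
  case=> [|k /asboolP Kk kmin]; first exact/asboolP.
  exists k; split=> // l Kl; have lN : (l < N.+1)%N by case: Kl => /andP[].
  by apply: (kmin (Ordinal lN)); exact/asboolP.
- move=> k [Kk kmin]; have [v vfeas] := index_feas k Kk; exists v; split=> // M v' c feas.
  have [_ KM Sc] := feas_index M c (ex_intro _ v' feas).
  exact: le_trans (kmin _ KM) ((minP _ KM).2 _ Sc).
- move=> M c [v [feas copt]].
  have [MN KM Sc] := feas_index M c (ex_intro _ v feas).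
  have copt_index l : tube_indices N S xi l -> c <= slice_min S xi l.
    by move=> /index_feas[v' feas']; exact: copt feas'.
  (* Optimality puts [c] below every slice minimum; feasibility puts [c] in the slice of index
     [N - M], hence above its minimum. *)
  have cE : c = slice_min S xi (N - M)%N.
    by apply/le_anti; rewrite copt_index//=; exact: (minP _ KM).2.
  exists (N - M)%N; split=> //; last by rewrite subKn// ltnW.
  by split=> // l Kl; rewrite -cE copt_index.
Qed.
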